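(* Fix an integer $p \geq 4$ and let $c$ be a sufficiently large constant (depending on $p$). Let $v_1,\ldots,v_n$ be independent, each uniformly distributed on $\{-1,+1\}^n$, and let the signs $x_1,\ldots,x_n\in\{-1,+1\}$ be chosen online by the following strategy: at round $t$, having seen $v_1,\ldots,v_t$, choose $x_t$ to minimize $\Phi(t)-\Phi(t-1)$, where $\Phi$ is the potential defined in the context. Then there are constants $K,a>0$ (depending on $p,c$) such that, with probability at least $1-\exp(-a n^{\gamma})$, where $\gamma = 1-2/p$, the value $V = \left|\sum_{t=1}^n x_t v_t\right|_\infty$ satisfies $V \leq K\sqrt{n}$; that is, $V=O(n^{1/2})$ with probability at least $1-\exp(-\Omega(n^\gamma))$.
   Context: Let $P_t = \sum_{s=1}^t x_s v_s\in\mathbb{R}^n$ (with $P_0=0$) and let $d_j(t)$ be the $j$-th coordinate of $P_t$. The gap of coordinate $j$ is $g_j(t) = cn - d_j(t)^2$, and the potential is $\Phi(t) = c^p n^{p-1}\sum_{j=1}^n g_j(t)^{-p}$ (so $\Phi(0)=1$). The potential blows up as some $|d_j(t)|$ approaches $\sqrt{cn}$. *)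

(* Defs.v *)
From mathcomp Require Import all_boot all_order all_algebra.
From mathcomp Require Import all_classical all_reals all_analysis.

Set Implicit Arguments.
Unset Strict Implicit.
Unset Printing Implicit Defensive.

Import Order.TTheory GRing.Theory Num.Theory.
Import numFieldNormedType.Exports.

Local Open Scope classical_set_scope.
Local Open Scope ring_scope.

(* Signs are booleans: b stands for (-1) ^+ b.  The cube {-1,+1}^n is then the
   finite type cube n, embedded in R^n by cube_vec. *)
Definition cube (n : nat) : finType := {ffun 'I_n -> bool}.

Definition cube_vec (R : realType) (n : nat) (e : cube n) : 'rV[R]_n :=
  \row_j (-1) ^+ e j.

(* A random element of a finite set U is a map X with measurable fibres. *)
Definition fin_random (d : measure_display)
    (T : measurableType d) (U : finType) (X : T -> U) : Prop :=
  forall e : U, measurable (X @^-1` [set e]).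

Definition uniformly_distributed (R : realType) (d : measure_display)
    (T : measurableType d) (P : probability T R) (U : finType)
    (X : T -> U) : Prop :=
  forall e : U, P (X @^-1` [set e]) = ((#|U|%:R)^-1)%:E.

Definition mutually_independent (R : realType) (d : measure_display)
    (T : measurableType d) (P : probability T R) (I U : finType)
    (X : I -> T -> U) : Prop :=
  forall (J : {set I}) (A : I -> set U),
    P (\bigcap_(i in [set i | i \in J]) (X i @^-1` A i)) =
    (\prod_(i in J) P (X i @^-1` A i))%E.

(* Rounds are numbered from 0, so that s : 'I_n is round s + 1 and
   position x v t is P_t, the sum over the first t rounds. *)
Definition position (R : realType) (n : nat) (x : 'I_n -> bool)
    (v : 'I_n -> cube n) (t : nat) : 'rV[R]_n :=
  \sum_(s < n | (s < t)%N) (-1) ^+ x s *: cube_vec R (v s).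

Definition gap (R : realType) (n : nat) (c : R) (u : 'rV[R]_n) (j : 'I_n) : R :=
  c * n%:R - u 0 j ^+ 2.

(* The inverse is that of \bar R, for which 0^-1 = +oo: the potential is
   infinite when a gap vanishes. *)
Definition potential (R : realType) (n p : nat) (c : R) (u : 'rV[R]_n) : \bar R :=
  ((c ^+ p * n%:R ^+ p.-1)%:E * \sum_(j < n) ((gap c u j)%:E ^-1) ^+ p)%E.

(* A strategy maps the whole input sequence to the sequence of signs; it is
   online when the sign of a round depends only on the vectors seen so far,
   that of the current round included. *)
Definition strategy (n : nat) := ('I_n -> cube n) -> 'I_n -> bool.

Definition online (n : nat) (S : strategy n) : Prop :=
  forall (v v' : 'I_n -> cube n) (t : 'I_n),
    (forall s : 'I_n, (s <= t)%N -> v s = v' s) -> S v t = S v' t.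

Definition potential_increment (R : realType) (n p : nat) (c : R)
    (u w : 'rV[R]_n) (b : bool) : \bar R :=
  (potential p c (u + (-1) ^+ b *: w) - potential p c u)%E.

(* Ties may be broken in any way. *)
Definition greedy (R : realType) (n p : nat) (c : R) (S : strategy n) : Prop :=
  forall (v : 'I_n -> cube n) (t : 'I_n) (b : bool),
    let u := position R (S v) v t in
    (potential_increment p c u (cube_vec R (v t)) (S v t) <=
     potential_increment p c u (cube_vec R (v t)) b)%E.

(* The norm of 'rV[R]_n is the sup norm. *)
Definition discrepancy (R : realType) (n : nat) (S : strategy n)
    (v : 'I_n -> cube n) : R :=
  `| position R (S v) v n |.

(* Main.v *)
Require Import Defs.
From mathcomp Require Import all_boot all_order all_algebra.
From mathcomp Require Import all_classical all_reals all_analysis.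
From mathcomp Require Import ring lra.

Import Order.TTheory GRing.Theory Num.Theory.
Import numFieldNormedType.Exports.

Local Open Scope classical_set_scope.
Local Open Scope ring_scope.

(** A Taylor expansion bounds the change of the potential by [x_t L + Q], where
    [L] is a Rademacher sum in the fresh vector, with coefficients of Euclidean
    norm [l], and [Q <= 1/n + B q].  The greedy sign makes it at most [Q - |L|].
    As long as [Phi <= 3], Cauchy-Schwarz gives [B q <= l / 8] for [c] large,
    and every gap is at least of order [n^(1 - 1/p)], which gives
    [q = O(n^(-gamma))].  With [lambda] a small multiple of [n^gamma], the
    Khinchine-type estimate [E exp(- lambda |L|) <= 1 - min(1, lambda l) / 8]
    then makes [exp(lambda (Phi(t) - t / n))], stopped when [Phi] exceeds 3, a
    supermartingale, so [Phi] exceeds 3 with probability at most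
    [exp(- lambda)].  If it never does, all gaps are positive at time [n]. *)

(** * Second-order expansion of an inverse power, for one coordinate *)

Lemma inv_pow_second_order (R : realFieldType) (p : nat) :
  exists2 C : R, 0 <= C & forall y : R, `|y| <= 1 / 2 ->
    (1 - y)^-1 ^+ p <= 1 + p%:R * y + C * y ^+ 2.
Proof.
elim: p => [|p [C C0 IH]].
  by exists 0 => // y _; rewrite expr0 mul0r mul0r !addr0.
have p0 : 0 <= p%:R :> R by [].
(* With this constant, once the claim is multiplied by [1 - y], its right side minus the inductive
   bound is exactly [(C + p + 1) y^2 (1 - 2 y)], which is nonnegative for [y <= 1 / 2]. *)
exists (2 * (C + p%:R + 1)) => [|y hy]; first by nra.
have := IH y hy; move: hy; rewrite ler_norml => /andP[y1 y2] IHy.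
have i0 : 0 < 1 - y by lra.
rewrite exprSr ler_pdivrMr //; apply: le_trans IHy _.
rewrite -natr1.
have h : 0 <= (C + p%:R + 1) * y ^+ 2 * (1 - 2 * y).
  by apply: mulr_ge0; [apply: mulr_ge0; [lra|exact: sqr_ge0]|lra].
nra.
Qed.

(** Here [d] is a coordinate, [e] its sign step, [m] stands for [c n] and [g] for the gap. The new
    gap is [g (1 - y)] with [y = (2 e d + 1) / g], to which the expansion of [(1 - y)^-p]
    applies. *)
Lemma inv_pow_step {R : realFieldType} (p : nat) (C m g d e : R) :
  (forall y : R, `|y| <= 1 / 2 ->
    (1 - y)^-1 ^+ p <= 1 + p%:R * y + C * y ^+ 2) -> 0 <= C ->
  e ^+ 2 = 1 -> g = m - d ^+ 2 -> 0 < g -> 2 <= m -> 36 * m <= g ^+ 2 ->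
  0 < m - (d + e) ^+ 2 /\
  (m - (d + e) ^+ 2)^-1 ^+ p <=
    g^-1 ^+ p + e * (2 * p%:R * d * g^-1 ^+ p.+1) +
    (p%:R + 2 * C) / m * g^-1 ^+ p +
    (p%:R + 10 * C) * (d ^+ 2 * g^-1 ^+ p.+2).
Proof.
move=> hC C0 he gE g0 m2 hg.
have d2 : 0 <= d ^+ 2 := sqr_ge0 d.
have i0 : 0 < g^-1 by rewrite invr_gt0.
have gi : g * g^-1 = 1 by rewrite divff // gt_eqF.
set i := g^-1 in i0 gi *.
set y := (2 * e * d + 1) * i.
have gE' : m - (d + e) ^+ 2 = g * (1 - y).
  by rewrite /y mulrBr mulr1 mulrCA gi mulr1 gE sqrrD he; ring.
have y2 : (2 * e * d + 1) ^+ 2 <= 8 * d ^+ 2 + 2.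
  have := sqr_ge0 (2 * e * d - 1).
  have -> : 8 * d ^+ 2 = 8 * e ^+ 2 * d ^+ 2 by rewrite he; ring.
  nra.
have mi2 : 36 * m * i ^+ 2 <= 1.
  have gi2 : g ^+ 2 * i ^+ 2 = 1 by rewrite -exprMn gi expr1n.
  by rewrite -[leRHS]gi2 ler_wpM2r ?sqr_ge0.
(* [y^2 <= (8 d^2 + 2) / g^2 <= 9 m / g^2 <= 1 / 4]; this is where [36 m <= g^2] comes from. *)
have hy : `|y| <= 1 / 2.
  rewrite -(@ler_pXn2r _ 2) ?nnegrE //.
  rewrite real_normK ?num_real // /y exprMn.
  apply: (@le_trans _ _ ((8 * d ^+ 2 + 2) * i ^+ 2)).
    by rewrite ler_wpM2r ?sqr_ge0 //.
  have : (8 * d ^+ 2 + 2) * i ^+ 2 <= 9 * m * i ^+ 2.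
    by rewrite ler_wpM2r ?sqr_ge0 //; lra.
  lra.
have y1 : 0 < 1 - y by move: hy; rewrite ler_norml; lra.
split; first by rewrite gE' mulr_gt0.
have i1 : i <= 1.
  rewrite -(@ler_pXn2r _ 2) ?nnegrE ?(ltW i0) // expr1n.
  have := sqr_ge0 i; nra.
have T0 : 0 <= i ^+ p by rewrite exprn_ge0 // ltW.
rewrite gE' invfM exprMn -/i.
apply: (@le_trans _ _ (i ^+ p * (1 + p%:R * y + C * y ^+ 2))).
  by rewrite ler_wpM2l // hC.
have m0 : 0 < m by lra.
(* The sign-free term [1 / g] equals [1 / m + d^2 / (g m)]. The first part will sum to order [1 / n]
   over the coordinates, and the second joins the quadratic error. *)
have im : i <= m^-1 + d ^+ 2 * i ^+ 2.
  have mi : m^-1 <= i by rewrite lef_pV2 ?posrE // gE; lra.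
  have iE : i = m^-1 + d ^+ 2 * i * m^-1.
    have mm : m * m^-1 = 1 by rewrite divff // gt_eqF.
    have : (m - d ^+ 2) * i = 1 by rewrite -gE.
    move=> h; rewrite -[LHS]mulr1 -{1}mm mulrCA.
    have -> : m * (i * m^-1) = ((m - d^+2) * i) * m^-1 + d ^+ 2 * i * m^-1 by ring.
    by rewrite h mul1r.
  rewrite {1}iE lerD2l.
  have -> : d ^+ 2 * i ^+ 2 = d ^+ 2 * i * i by ring.
  by rewrite ler_wpM2l // mulr_ge0 // ltW.
rewrite !exprSr.
set T := i ^+ p in T0 *.
have p0 : 0 <= p%:R :> R by [].
have hy2 : C * y ^+ 2 <= C * (8 * (d ^+ 2 * i ^+ 2) + 2 * i).
  rewrite ler_wpM2l // /y exprMn.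
  apply: (@le_trans _ _ ((8 * d ^+ 2 + 2) * i ^+ 2)).
    by rewrite ler_wpM2r ?sqr_ge0 //.
  have : i ^+ 2 <= i by rewrite expr2 ler_piMr // ltW.
  lra.
have hp : (p%:R + 2 * C) * i <= (p%:R + 2 * C) * (m^-1 + d ^+ 2 * i ^+ 2).
  by rewrite ler_wpM2l //; lra.
have key : p%:R * y + C * y ^+ 2 <= e * (2 * p%:R * d * i) +
    (p%:R + 2 * C) * m^-1 + (p%:R + 10 * C) * (d ^+ 2 * i ^+ 2).
  have yE : p%:R * y = e * (2 * p%:R * d * i) + p%:R * i by rewrite /y; ring.
  lra.
have := ler_wpM2l T0 key.
lra.
Qed.

(** * The real-valued potential, safe positions and the expansion of one round *)

Section Potential.
Context {R : realType} (n p : nat) (c : R).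
Implicit Types (u : 'rV[R]_n) (w : cube n) (j : 'I_n).

Definition pot_scale : R := c ^+ p * n%:R ^+ p.-1.

Definition rpot u : R := pot_scale * \sum_j (gap c u j)^-1 ^+ p.

(** Positivity is a separate clause because the real inverse sends 0 to 0 and keeps negative values
    finite: a bound on [rpot] alone does not exclude zero or negative gaps. *)
Definition safe u : bool := [forall j, 0 < gap c u j] && (rpot u <= 3).

(** The partial derivative of [rpot] in coordinate [j]; [lin_part] is thus the derivative along a
    cube vector, the [L] of the overview, and [quad_part] is its [q]. *)
Definition lin_coef u j : R :=
  pot_scale * (2 * p%:R * u 0 j * (gap c u j)^-1 ^+ p.+1).

Definition lin_part u w : R := \sum_j (-1) ^+ w j * lin_coef u j.

Definition quad_part u : R :=
  pot_scale * \sum_j (u 0 j ^+ 2 * (gap c u j)^-1 ^+ p.+2).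

Lemma potential_fin u : (forall j, 0 < gap c u j) ->
  potential p c u = (rpot u)%:E.
Proof.
move=> g0; rewrite /potential /rpot [RHS]EFinM -sumEFin; congr (_ * _)%E.
apply: eq_bigr => j _.
by rewrite inver gt_eqF ?g0 // -EFin_expe.
Qed.

Lemma gap_le u j : gap c u j <= c * n%:R.
Proof. by rewrite /gap gerBl sqr_ge0. Qed.

Lemma pot_scale_pow : (0 < p)%N -> (0 < n)%N -> pot_scale * n%:R = (c * n%:R) ^+ p.
Proof.
by move=> p0 n0; rewrite /pot_scale -mulrA -exprSr prednK // exprMn.
Qed.

Hypotheses (p2 : (2 <= p)%N) (n0 : (0 < n)%N) (c324 : 324 <= c).

Let p0 : (0 < p)%N. Proof. exact: leq_trans p2. Qed.
Let n1 : 1 <= n%:R :> R. Proof. by rewrite ler1n. Qed.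

Let c_gt0 : 0 < c. Proof. by move: c324 => h; lra. Qed.

Lemma pot_scale_gt0 : 0 < pot_scale.
Proof. by apply: mulr_gt0; apply: exprn_gt0; rewrite ?ltr0n. Qed.

Lemma cn_ge : 324 <= c * n%:R.
Proof. by move: c324 n1 => ? ?; nra. Qed.

Lemma rpot0 : rpot 0 = 1.
Proof.
rewrite /rpot (eq_bigr (fun=> (c * n%:R)^-1 ^+ p)); last first.
  by move=> j _; rewrite /gap mxE expr0n subr0.
rewrite sumr_const card_ord -[_ *+ n]mulr_natl mulrA pot_scale_pow //.
by rewrite -exprMn divff ?expr1n // gt_eqF //; have := cn_ge; lra.
Qed.

Lemma safe0 : safe 0.
Proof.
apply/andP; split; last by rewrite rpot0; lra.
by apply/forallP => j; rewrite /gap mxE expr0n subr0; have := cn_ge; lra.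
Qed.

(* Every term of the potential is at most 3, so [c n / g <= (3 n) ^ (1 / p)]. *)
Lemma safe_gap u j : safe u ->
  c * n%:R * (gap c u j)^-1 ^+ 2 <= 9 / c / n%:R `^ (1 - 2 / p%:R).
Proof.
move=> /andP[/forallP g0 h3].
have cn := cn_ge.
have gj := g0 j.
have i0 : 0 < (gap c u j)^-1 by rewrite invr_gt0.
set r : R := n%:R `^ p%:R^-1.
have r0 : 0 <= r by exact: powR_ge0.
have pr : p%:R != 0 :> R by rewrite pnatr_eq0 -lt0n.
have rp : r ^+ p = n%:R.
  by rewrite -powR_mulrn // -powRrM mulVf // powRr1.
have r2 : r ^+ 2 = n%:R `^ (2 / p%:R).
  by rewrite -powR_mulrn // -powRrM mulrC.
have le_r : c * n%:R * (gap c u j)^-1 <= 3 * r.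
  rewrite -(@ler_pXn2r _ p) // ?nnegrE ?mulr_ge0 ?(ltW i0) ?(ltW c_gt0) //.
  rewrite !exprMn rp -exprMn -pot_scale_pow // mulrAC ler_wpM2r //.
  apply: (@le_trans _ _ 3); last first.
    by rewrite -{1}[3]expr1 ler_weXn2l //; lra.
  apply: le_trans h3; rewrite ler_wpM2l ?(ltW pot_scale_gt0) //.
  rewrite (bigD1 j) //= lerDl sumr_ge0 // => k _.
  by rewrite exprn_ge0 // invr_ge0 ltW.
rewrite powRB; last by apply/implyP => _; rewrite pnatr_eq0 -lt0n.
rewrite powRr1 // -r2 invf_div.
have h2 : (c * n%:R * (gap c u j)^-1) ^+ 2 <= (3 * r) ^+ 2.
  by rewrite ler_pXn2r // nnegrE ?mulr_ge0 ?(ltW i0) ?(ltW c_gt0).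
rewrite -(@ler_pM2l _ (c * n%:R)); last by lra.
apply: (le_trans (y := (c * n%:R * (gap c u j)^-1) ^+ 2)).
  by rewrite exprMn expr2 mulrA.
apply: (le_trans h2).
rewrite le_eqVlt; apply/orP; left; apply/eqP; field.
by rewrite pnatr_eq0 -lt0n n0 gt_eqF.
Qed.

Lemma quad_part_ge0 u : safe u -> 0 <= quad_part u.
Proof.
move=> /andP[/forallP g0 _]; rewrite mulr_ge0 ?(ltW pot_scale_gt0) //.
by apply: sumr_ge0 => j _; rewrite mulr_ge0 ?sqr_ge0 // exprn_ge0 // invr_ge0 ltW.
Qed.

(** Positive gaps give [u_j^2 <= c n], so [safe_gap] bounds every factor [u_j^2 / g_j^2] uniformly;
    what remains is the potential, at most 3. *)
Lemma quad_part_le u : safe u ->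
  quad_part u <= 27 / c / n%:R `^ (1 - 2 / p%:R).
Proof.
move=> su; have /andP[/forallP g0 h3] := su.
set G := n%:R `^ _.
have G0 : 0 < G by apply: powR_gt0; rewrite ltr0n.
have c0 := c_gt0.
have K0 : 0 <= 9 / c / G by rewrite !divr_ge0 // ltW.
have -> : 27 / c / G = 3 * (9 / c / G) by rewrite !mulrA; congr (_ / _ / _); ring.
apply: (@le_trans _ _ (rpot u * (9 / c / G))); last by rewrite ler_wpM2r.
rewrite /rpot -mulrA ler_wpM2l ?(ltW pot_scale_gt0) // mulr_suml.
apply: ler_sum => j _.
have i0 : 0 < (gap c u j)^-1 by rewrite invr_gt0.
have -> : u 0 j ^+ 2 * (gap c u j)^-1 ^+ p.+2 =
  (gap c u j)^-1 ^+ p * (u 0 j ^+ 2 * (gap c u j)^-1 ^+ 2).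
  by rewrite [RHS]mulrCA -exprD addn2.
rewrite ler_wpM2l ?exprn_ge0 ?(ltW i0) //.
apply: le_trans (safe_gap u j su); rewrite ler_wpM2r ?sqr_ge0 //.
by have := g0 j; rewrite /gap subr_gt0 => /ltW.
Qed.

(** Each term of [quad_part] is [lin_coef u j * (u_j / g_j)] divided by [2 p], and the vector of the
    [u_j / g_j] has squared norm at most [3 / c]. Cauchy-Schwarz then gives a multiple of
    [l / sqrt c], and a large [c] absorbs [B]. *)
Lemma quad_part_le_lin (B : R) u : 1 <= B -> 192 * B ^+ 2 <= c -> safe u ->
  B * quad_part u <= Num.sqrt (\sum_j lin_coef u j ^+ 2) / 8.
Proof.
move=> B1 hB su; have /andP[/forallP g0 h3] := su.
set s := \sum_j _ ^+ 2; set l := Num.sqrt s.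
have s0 : 0 <= s by apply: sumr_ge0 => j _; exact: sqr_ge0.
have l2 : l ^+ 2 = s by rewrite sqr_sqrtr.
have c0 := c_gt0.
(* As [c n / g_j >= 1] and [p >= 2], [(c n / g_j)^2 <= (c n / g_j)^p], which is [n] times the [j]-th
   term of the potential. Dividing by [c n] and summing yields [Phi / c]. *)
have e2 : \sum_j (u 0 j / gap c u j) ^+ 2 <= 3 / c.
  apply: (@le_trans _ _ (rpot u / c)); last by rewrite ler_pM2r // invr_gt0.
  rewrite /rpot mulr_sumr mulr_suml; apply: ler_sum => j _.
  have gj := g0 j; have i0 : 0 < (gap c u j)^-1 by rewrite invr_gt0.
  have d2 : u 0 j ^+ 2 <= c * n%:R by move: gj; rewrite /gap subr_gt0 => /ltW.
  have cn := cn_ge; have gle := gap_le u j.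
  have h1 : 1 <= c * n%:R / gap c u j by rewrite ler_pdivlMr // mul1r.
  apply: (@le_trans _ _ (c * n%:R * (gap c u j)^-1 ^+ 2)).
    by rewrite exprMn ler_wpM2r // sqr_ge0.
  rewrite -(@ler_pM2l _ (c * n%:R)); last by lra.
  rewrite mulrA -expr2 -exprMn.
  apply: (@le_trans _ _ ((c * n%:R / gap c u j) ^+ p)); first exact: ler_weXn2l.
  rewrite exprMn -pot_scale_pow // le_eqVlt; apply/orP; left; apply/eqP.
  by field; rewrite !gt_eqF.
(* The weights used below divide by [l]. If [l = 0], every [lin_coef] vanishes, which forces [u = 0]
   and makes [quad_part] vanish too. *)
have [l0|l0] := eqVneq l 0.
  have a0 j : lin_coef u j = 0.
    have := l2; rewrite l0 expr0n /= => /esym/eqP.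
    rewrite psumr_eq0 => [/allP/(_ j)|k _]; last exact: sqr_ge0.
    by rewrite mem_index_enum sqrf_eq0 => /(_ isT)/eqP.
  rewrite l0 mul0r /quad_part big1 ?mulr0 // => j _.
  have /eqP := a0 j; rewrite mulf_eq0 (gt_eqF pot_scale_gt0) orFb.
  rewrite mulf_eq0 expf_eq0 invr_eq0 (gt_eqF (g0 j)) andbF orbF.
  rewrite mulf_eq0 mulf_eq0 !pnatr_eq0 (gtn_eqF p0) !orFb => /eqP ->.
  by rewrite expr0n mul0r.
have lp : 0 < l by rewrite lt_def l0 sqrtr_ge0.
have B0 : 0 < B by lra.
have qE : quad_part u <= \sum_j `|lin_coef u j * (u 0 j / gap c u j)|.
  rewrite /quad_part mulr_sumr; apply: ler_sum => j _.
  have i0 : 0 < (gap c u j)^-1 by rewrite invr_gt0.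
  apply: le_trans (ler_norm _); rewrite /lin_coef.
  set q := pot_scale * (u 0 j ^+ 2 * (gap c u j)^-1 ^+ p.+2).
  have q0 : 0 <= q.
    rewrite mulr_ge0 ?(ltW pot_scale_gt0) // mulr_ge0 ?sqr_ge0 //.
    by rewrite exprn_ge0 // ltW.
  have -> : pot_scale * (2 * p%:R * u 0 j * (gap c u j)^-1 ^+ p.+1) *
     (u 0 j / gap c u j) = 2 * p%:R * q.
    by rewrite /q (exprSr _ p.+1); ring.
  have p1 : 1 <= p%:R :> R by rewrite ler1n.
  nra.
(* AM-GM, weighted so that both squares sum to at most [l / (16 B)]. *)
have amgm j : `|lin_coef u j * (u 0 j / gap c u j)| <=
    lin_coef u j ^+ 2 / (16 * B * l) + 4 * B * l * (u 0 j / gap c u j) ^+ 2.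
  set a := lin_coef u j; set e := u 0 j / _.
  rewrite normrM -(real_normK (num_real a)) -(real_normK (num_real e)).
  set a' := `|a|; set e' := `|e|.
  have t0 : 0 < 8 * B * l by rewrite !mulr_gt0.
  have := sqr_ge0 (a' - 8 * B * l * e').
  move: t0; set t := 8 * B * l => t0 sq.
  have -> : 16 * B * l = 2 * t by rewrite /t; ring.
  have -> : 4 * B * l = t / 2 by rewrite /t; field.
  rewrite -subr_ge0.
  have -> : a' ^+ 2 / (2 * t) + t / 2 * e' ^+ 2 - a' * e' =
     (a' - t * e') ^+ 2 / (2 * t) by field; rewrite gt_eqF.
  by rewrite divr_ge0 // mulr_ge0 // ltW.
have hq : quad_part u <= s / (16 * B * l) + 4 * B * l * (3 / c).
  apply: le_trans qE _; apply: (le_trans (ler_sum _ (fun j _ => amgm j))).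
  rewrite big_split /= -mulr_suml -mulr_sumr lerD2l ler_wpM2l //.
  by rewrite !mulr_ge0 // ltW.
rewrite mulrC -ler_pdivlMr //; apply: le_trans hq _.
have -> : s / (16 * B * l) = l / 16 / B.
  by rewrite -l2; field; rewrite !gt_eqF.
(* This inequality amounts to [192 B^2 <= c]. *)
have hc : 4 * B * l * (3 / c) <= l / 16 / B.
  rewrite mulrA ler_pdivrMr // [leRHS]mulrAC ler_pdivlMr //.
  have := ler_wpM2l (ltW lp) hB; lra.
apply: (@le_trans _ _ (l / 16 / B + l / 16 / B)); first by rewrite lerD2l.
by rewrite le_eqVlt; apply/orP; left; apply/eqP; field; rewrite gt_eqF.
Qed.

(** Sum [inv_pow_step] with [m = c n] over the coordinates. Its [1 / m] terms add up to
    [(p + 2 C) Phi / (c n)], at most [1 / n] because [Phi <= 3] and [3 (p + 2 C) <= c]. *)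
Lemma rpot_step (C : R) u w (b : bool) :
  (forall y : R, `|y| <= 1 / 2 ->
    (1 - y)^-1 ^+ p <= 1 + p%:R * y + C * y ^+ 2) -> 0 <= C ->
  3 * (p%:R + 2 * C) <= c -> safe u ->
  let u' := u + (-1) ^+ b *: cube_vec R w in
  (forall j, 0 < gap c u' j) /\
  rpot u' <= rpot u + (-1) ^+ b * lin_part u w + n%:R^-1 +
             (p%:R + 10 * C) * quad_part u.
Proof.
move=> hC C0 hc su u'; have /andP[/forallP g0 h3] := su.
have cn := cn_ge; have c0 := c_gt0.
have step j := @inv_pow_step R p C (c * n%:R) (gap c u j) (u 0 j)
  ((-1) ^+ b * (-1) ^+ w j) hC C0.
have gE j : gap c u' j = c * n%:R - (u 0 j + (-1) ^+ b * (-1) ^+ w j) ^+ 2.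
  by rewrite /gap !mxE.
have e2 j : ((-1) ^+ b * (-1) ^+ w j) ^+ 2 = 1 :> R.
  by rewrite exprMn !sqrr_sign mulr1.
(* [safe_gap] gives [c n / g^2 <= 9 / c], since the power of [n] is at least 1, and
   [9 / c <= 1 / 36] is the condition [324 <= c]. *)
have g2 j : 36 * (c * n%:R) <= gap c u j ^+ 2.
  have gj := g0 j.
  have := safe_gap u j su.
  have G1 : 1 <= n%:R `^ (1 - 2 / p%:R) :> R.
    rewrite -[leLHS](powRr0 n%:R) ler_powR // subr_ge0.
    by rewrite ler_pdivrMr ?ltr0n // mul1r ler_nat.
  rewrite exprVn ler_pdivrMr ?exprn_gt0 // => h.
  have : 9 / c / n%:R `^ (1 - 2 / p%:R) <= 36^-1.
    rewrite ler_pdivrMr ?(lt_le_trans ltr01) // ler_pdivrMr //.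
    have c3 := c324; have := ler_wpM2l (ltW c0) G1; lra.
  move=> h'; have := ler_wpM2r (sqr_ge0 (gap c u j)) h'; lra.
have {}step j := step j (e2 j) erefl (g0 j) _ (g2 j).
have m2 : 2 <= c * n%:R by lra.
split=> [j|]; first by rewrite gE; have [] := step m2 j.
apply: (@le_trans _ _ (rpot u + (-1) ^+ b * lin_part u w +
    (p%:R + 2 * C) / (c * n%:R) * rpot u + (p%:R + 10 * C) * quad_part u)).
  rewrite /rpot /lin_part /quad_part.
  rewrite [(p%:R + 10 * C) * _]mulrCA [_ / _ * (_ * _)]mulrCA.
  rewrite !mulr_sumr -!big_split /=; apply: ler_sum => j _.
  have [_] := step m2 j; rewrite -gE => /(ler_wpM2l (ltW pot_scale_gt0)).
  move/le_trans; apply; rewrite le_eqVlt; apply/orP; left; apply/eqP.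
  by rewrite /lin_coef; ring.
rewrite lerD2r lerD2l.
have P0 : 0 <= p%:R :> R by [].
apply: (@le_trans _ _ ((p%:R + 2 * C) / (c * n%:R) * 3)).
  by rewrite ler_wpM2l // divr_ge0 //; lra.
rewrite invfM mulrA mulrAC -[leRHS]mul1r ler_wpM2r ?invr_ge0 //.
by rewrite mulrAC ler_pdivrMr // mul1r mulrC.
Qed.

End Potential.

Arguments rpot {R n}.
Arguments safe {R n}.
Arguments lin_coef {R n}.
Arguments lin_part {R n}.
Arguments quad_part {R n}.

(** * Moments and exponential moments of Rademacher sums *)

Section Rademacher.
Context {R : realType} (I : finType).
Implicit Types (w : {ffun I -> bool}) (a : I -> R) (s : seq I) (i : I).

Definition flip_sign i w : {ffun I -> bool} :=
  [ffun j => if j == i then ~~ w j else w j].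

Lemma flip_signK i : involutive (flip_sign i).
Proof.
by move=> w; apply/ffunP => j; rewrite !ffunE; case: eqP => // _; rewrite negbK.
Qed.

Lemma sum_sign_eq0 i (F : {ffun I -> bool} -> R) :
  (forall w, F (flip_sign i w) = F w) -> \sum_(w : {ffun I -> bool}) (-1) ^+ w i * F w = 0.
Proof.
move=> hF; set S := \sum_w _.
have SN : S = - S.
  rewrite {1}/S (reindex_inj (inv_inj (flip_signK i))) /S -sumrN.
  apply: eq_bigr => w _.
  by rewrite hF ffunE eqxx; case: (w i); rewrite ?expr0 ?expr1; ring.
lra.
Qed.

(** Summing over a list of indices allows induction on the list while the space of signs stays
    fixed. *)
Definition signed_sum a s w : R := \sum_(j <- s) (-1) ^+ w j * a j.

Lemma signed_sum_flip a s i w : i \notin s ->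
  signed_sum a s (flip_sign i w) = signed_sum a s w.
Proof.
move=> si; apply: eq_big_seq => j js; rewrite ffunE; case: eqP => // ji.
by rewrite -ji js in si.
Qed.

Let N : R := #|{ffun I -> bool}|%:R.

Lemma signed_sum_sqr a s : uniq s ->
  \sum_w signed_sum a s w ^+ 2 = N * \sum_(j <- s) a j ^+ 2.
Proof.
elim: s => [_|i s IH /= /andP[si us]].
  by rewrite big_nil mulr0 big1 // => w _; rewrite /signed_sum big_nil expr0n.
rewrite big_cons mulrDr -IH //.
rewrite (eq_bigr (fun w => a i ^+ 2 +
    ((-1) ^+ w i * (2 * a i * signed_sum a s w) + signed_sum a s w ^+ 2))).
  rewrite !big_split /= sum_sign_eq0 => [|w]; last by rewrite signed_sum_flip.
  by rewrite add0r sumr_const -[_ *+ _]mulr_natl.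
move=> w _; rewrite {1}/signed_sum big_cons -/(signed_sum a s w).
by rewrite sqrrD exprMn sqrr_sign; ring.
Qed.

(** Split off the sign of [i]: its odd powers average to zero. With [q] the sum of the remaining
    squares, [a_i^4 + 6 a_i^2 q + 3 q^2 <= 3 (a_i^2 + q)^2]. *)
Lemma signed_sum_exp4 a s : uniq s ->
  \sum_w signed_sum a s w ^+ 4 <= 3 * N * (\sum_(j <- s) a j ^+ 2) ^+ 2.
Proof.
elim: s => [_|i s IH /= /andP[si us]].
  rewrite big_nil expr0n mulr0 big1 // => w _.
  by rewrite /signed_sum big_nil expr0n.
have := IH us; have := signed_sum_sqr a s us.
rewrite big_cons; set q := \sum_(j <- s) _ => S2 S4.
rewrite (eq_bigr (fun w => a i ^+ 4 + ((-1) ^+ w i *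
    (4 * a i ^+ 3 * signed_sum a s w + 4 * a i * signed_sum a s w ^+ 3) +
    (6 * a i ^+ 2 * signed_sum a s w ^+ 2 + signed_sum a s w ^+ 4)))).
  rewrite !big_split /= sum_sign_eq0 => [|w]; last by rewrite signed_sum_flip.
  rewrite add0r sumr_const -[_ *+ _]mulr_natl -/N -mulr_sumr S2.
  have N0 : 0 <= N by [].
  have := mulr_ge0 N0 (sqr_ge0 (a i ^+ 2)); nra.
move=> w _; rewrite {1}/signed_sum big_cons -/(signed_sum a s w).
set L := signed_sum a s w; case: (w i); rewrite ?expr0 ?expr1; ring.
Qed.

End Rademacher.

Arguments signed_sum {R I}.

Lemma expRN_le {R : realType} (x : R) : 0 <= x ->
  expR (- x) <= 1 - Num.min 1 x / 2.
Proof.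
move=> x0; rewrite expRN.
apply: (@le_trans _ _ (1 + x)^-1).
  by rewrite lef_pV2 ?posrE ?expR_gt0 ?expR_ge1Dx //; lra.
rewrite -[leLHS]mul1r ler_pdivrMr; last by lra.
by case: (leP 1 x) => h; nra.
Qed.

(* With [z = |L| / l], [min 1 z >= z^2 - z^4 / 4], so the second and fourth
   moments give [E (min 1 z) >= 1 - 3 / 4]. *)
Lemma sum_exp_signed_sum {R : realType} (I : finType) (a : I -> R) (la : R) :
  0 <= la ->
  \sum_(w : {ffun I -> bool}) expR (- (la * `|\sum_j (-1) ^+ w j * a j|)) <=
  #|{ffun I -> bool}|%:R *
    (1 - Num.min 1 (la * Num.sqrt (\sum_j a j ^+ 2)) / 8).
Proof.
move=> la0; set s := \sum_j a j ^+ 2; pose l : R := Num.sqrt s; rewrite -/l.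
set N : R := #|_|%:R.
have N0 : 0 <= N by [].
have [l0|l0] := eqVneq l 0.
  apply: (@le_trans _ _ (\sum_(w : {ffun I -> bool}) 1)).
    by apply: ler_sum => w _; rewrite -expR0 ler_expR oppr_le0 mulr_ge0.
  by rewrite sumr_const l0 mulr0 (min_idPr _) // mul0r subr0 mulr1.
have s0 : 0 <= s by apply: sumr_ge0 => j _; exact: sqr_ge0.
have lp : 0 < l by rewrite lt_def l0 sqrtr_ge0.
have l2 : l ^+ 2 = s by rewrite sqr_sqrtr.
set m := Num.min 1 (la * l).
have m0 : 0 <= m by rewrite /m le_min ler01 mulr_ge0 // ltW.
have m1 : m <= 1 by rewrite /m ge_min lexx.
have ml : m <= la * l by rewrite /m ge_min lexx orbT.
set L := signed_sum a (index_enum I).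
have pt w : expR (- (la * `|L w|)) <=
    1 - m / 2 * (L w ^+ 2 / l ^+ 2 - L w ^+ 4 / l ^+ 4 / 4).
  apply: (le_trans (expRN_le _ _)); first by rewrite mulr_ge0.
  have [z z0 LE] : exists2 z : R, 0 <= z & `|L w| = l * z.
    exists (`|L w| / l); first by rewrite divr_ge0 // ltW.
    by rewrite mulrC divfK // gt_eqF.
  have L2 : L w ^+ 2 = (l * z) ^+ 2 by rewrite -LE real_normK // num_real.
  have L4 : L w ^+ 4 = (l * z) ^+ 4.
    by rewrite (exprM _ 2 2) L2 -exprM.
  rewrite L2 L4 LE !exprMn.
  have -> : l ^+ 2 * z ^+ 2 / l ^+ 2 = z ^+ 2 by field; rewrite gt_eqF.
  have -> : l ^+ 4 * z ^+ 4 / l ^+ 4 = z ^+ 4 by field; rewrite gt_eqF.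
  set q := z ^+ 2 - z ^+ 4 / 4.
  have q1 : q <= 1.
    have := sqr_ge0 (z ^+ 2 / 2 - 1); rewrite /q; nra.
  have qz : q <= z.
    have [z1|z1] := leP z 1; last by lra.
    have z4 : 0 <= z ^+ 4 by rewrite exprn_ge0.
    have : z ^+ 2 <= z by rewrite expr2 ler_piMr.
    rewrite /q; lra.
  (* Since [q] is at most 1 and at most [z], while [m] is at most 1 and at most [la * l], the factor
     [m] comes out of the minimum and only moments of [z] remain to be averaged. *)
  have : m * q <= Num.min 1 (la * (l * z)).
    rewrite le_min; apply/andP; split; first by nra.
    rewrite mulrA; apply: (@le_trans _ _ (m * z)); first exact: ler_wpM2l.
    exact: ler_wpM2r.
  lra.
apply: (le_trans (ler_sum _ (fun w _ => pt w))).
rewrite sumrB sumr_const -[_ *+ _]mulr_natl -/N mulr1 -mulr_sumr sumrB.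
rewrite -!mulr_suml signed_sum_sqr ?index_enum_uniq // -/s l2.
have /= := @signed_sum_exp4 R I a _ (index_enum_uniq I); rewrite -/s -/N.
rewrite -/L => h4.
have s00 : 0 < s by rewrite -l2 exprn_gt0.
have -> : l ^+ 4 = s ^+ 2 by rewrite -l2 -exprM.
have h5 : \sum_w L w ^+ 4 / s ^+ 2 <= 3 * N.
  by rewrite -mulr_suml ler_pdivrMr // exprn_gt0.
rewrite -mulr_suml in h5.
have -> : N * s / s = N by field; rewrite gt_eqF.
have := ler_wpM2l m0 h5.
lra.
Qed.

(** * One greedy round, averaged over the fresh vector *)

Lemma potential_increment_fin (R : realType) (n p : nat) (c : R)
    (u : 'rV[R]_n) (w : cube n) (b : bool) :
  let u' := u + (-1) ^+ b *: cube_vec R w in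
  (forall j, 0 < gap c u j) -> (forall j, 0 < gap c u' j) ->
  potential_increment p c u (cube_vec R w) b = (rpot p c u' - rpot p c u)%:E.
Proof. by move=> u' g0 g0'; rewrite /potential_increment !potential_fin. Qed.

Section GreedyStep.
Context {R : realType} (n p : nat) (c C la : R).
Hypothesis hC : forall y : R, `|y| <= 1 / 2 ->
  (1 - y)^-1 ^+ p <= 1 + p%:R * y + C * y ^+ 2.
Hypotheses (C0 : 0 <= C) (p2 : (2 <= p)%N) (n0 : (0 < n)%N).
Hypotheses (c324 : 324 <= c) (cB1 : 3 * (p%:R + 2 * C) <= c).
Hypothesis cB2 : 192 * (p%:R + 10 * C) ^+ 2 <= c.
Hypotheses (la0 : 0 <= la).
Hypothesis laB :
  la * ((p%:R + 10 * C) * (27 / c / n%:R `^ (1 - 2 / p%:R))) <= 1 / 8.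

(** Compare the greedy sign with the sign opposing [lin_part]. Both moves keep the gaps positive, so
    the comparison of extended increments is one of real numbers. *)
Lemma greedy_rpot (u : 'rV[R]_n) (w : cube n) (b : bool) : safe p c u ->
  (forall b', (potential_increment p c u (cube_vec R w) b <=
               potential_increment p c u (cube_vec R w) b')%E) ->
  let u' := u + (-1) ^+ b *: cube_vec R w in
  (forall j, 0 < gap c u' j) /\
  rpot p c u' <= rpot p c u - `|lin_part p c u w| + n%:R^-1 +
                 (p%:R + 10 * C) * quad_part p c u.
Proof.
move=> su hb u'; have /andP[/forallP g0 _] := su.
have step b' := @rpot_step R n p c p2 n0 c324 C u w b' hC C0 cB1 su.
split; first by have [] := step b.
have [b' hb'] : exists b' : bool,
    (-1) ^+ b' * lin_part p c u w = - `|lin_part p c u w|.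
  case: (leP 0 (lin_part p c u w)) => h.
    by exists true; rewrite expr1 mulN1r ger0_norm.
  by exists false; rewrite expr0 mul1r ltr0_norm ?opprK.
have [g1 _] := step b; have [g1' h] := step b'.
rewrite -hb'; apply: le_trans h.
have := hb b'; rewrite !potential_increment_fin //.
by rewrite lee_fin lerD2r.
Qed.

(** With [m = min 1 (la l)], the quadratic error contributes at most [exp(m / 8)] and the gain [|L|]
    a factor [1 - m / 8] on average; their product is at most 1. *)
Lemma greedy_exp_step (u : 'rV[R]_n) (b : cube n -> bool) : safe p c u ->
  (forall w b', (potential_increment p c u (cube_vec R w) (b w) <=
                 potential_increment p c u (cube_vec R w) b')%E) ->
  \sum_(w : cube n)
    expR (la * (rpot p c (u + (-1) ^+ b w *: cube_vec R w) - n%:R^-1)) <=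
  #|cube n|%:R * expR (la * rpot p c u).
Proof.
move=> su hb.
set B := p%:R + 10 * C; set q := quad_part p c u.
set l := Num.sqrt (\sum_j lin_coef p c u j ^+ 2).
set m := Num.min 1 (la * l).
have p1 : 1 <= p%:R :> R by rewrite ler1n (leq_trans _ p2).
have B1 : 1 <= B by rewrite /B; move: C0 => ?; lra.
(* The two bounds on [q] serve the two sides of the minimum: the uniform one gives [1 / 8], the one
   by [l] gives [la l / 8]. *)
have hq : la * (B * q) <= m / 8.
  have h1 : la * (B * q) <= 1 / 8.
    apply: le_trans laB; rewrite ler_wpM2l // -/B ler_wpM2l //; first by lra.
    exact: quad_part_le.
  have h2 : la * (B * q) <= la * l / 8.
    by rewrite -mulrA ler_wpM2l // quad_part_le_lin.
  by rewrite /m; case: (leP 1 (la * l)).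
apply: (@le_trans _ _ (\sum_(w : cube n) expR (la * rpot p c u) *
    (expR (m / 8) * expR (- (la * `|lin_part p c u w|))))).
  apply: ler_sum => w _; rewrite -!expRD ler_expR.
  have [_ /(ler_wpM2l la0)] := greedy_rpot _ _ _ su (hb w).
  rewrite -/B -/q; lra.
rewrite -!mulr_sumr mulrC -[leRHS]mulrC mulrC ler_wpM2l ?expR_ge0 //.
apply: (@le_trans _ _ (expR (m / 8) * (#|cube n|%:R * (1 - m / 8)))).
  by rewrite ler_wpM2l ?expR_ge0 // sum_exp_signed_sum.
rewrite mulrCA -[leRHS]mulr1 ler_wpM2l //.
rewrite -[leRHS](expRxMexpNx_1 (m / 8)) ler_wpM2l ?expR_ge0 //.
by have := expR_ge1Dx (- (m / 8)).
Qed.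

End GreedyStep.

(** * Averaging by resampling one coordinate *)

Section Resample.
Context (I U : finType).
Implicit Types (e : {ffun I -> U}) (i : I) (x : U).

Definition update e i x : {ffun I -> U} := [ffun k => if k == i then x else e k].

(** Exchanging [x] with the entry of [e] at [i] is an involution on pairs. This identity replaces
    conditional expectation given the other entries. *)
Lemma sum_update (V : nmodType) i (F : {ffun I -> U} -> V) :
  \sum_e \sum_x F (update e i x) = (\sum_e F e) *+ #|U|.
Proof.
rewrite pair_big /=.
pose f (y : {ffun I -> U} * U) := (update y.1 i y.2, y.1 i).
have fK : involutive f.
  move=> [e x]; rewrite /f /= ffunE eqxx; congr (_, _).
  by apply/ffunP => k; rewrite !ffunE; case: eqP => [->|].
rewrite (reindex_inj (inv_inj fK)) /=.
rewrite (eq_bigr (fun y => F y.1)); last first.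
  move=> [e x] _ /=; congr F; apply/ffunP => k; rewrite !ffunE.
  by case: eqP => [->|]; rewrite ?eqxx.
rewrite -(pair_big xpredT xpredT (fun e _ => F e)) /= -sumrMnl.
by apply: eq_bigr => e _; rewrite sumr_const.
Qed.

End Resample.

Arguments update {I U}.

(** * The stopped exponential supermartingale *)

Section Process.
Context {R : realType} (n p : nat) (c C la : R).
Hypothesis hC : forall y : R, `|y| <= 1 / 2 ->
  (1 - y)^-1 ^+ p <= 1 + p%:R * y + C * y ^+ 2.
Hypotheses (C0 : 0 <= C) (p2 : (2 <= p)%N) (n0 : (0 < n)%N).
Hypotheses (c324 : 324 <= c) (cB1 : 3 * (p%:R + 2 * C) <= c).
Hypothesis cB2 : 192 * (p%:R + 10 * C) ^+ 2 <= c.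
Hypotheses (la0 : 0 <= la).
Hypothesis laB :
  la * ((p%:R + 10 * C) * (27 / c / n%:R `^ (1 - 2 / p%:R))) <= 1 / 8.
Variable S : strategy n.
Hypotheses (onS : online S) (grS : greedy p c S).
Implicit Types (e : {ffun 'I_n -> cube n}) (t : nat).

Definition pos e t : 'rV[R]_n := position R (S e) e t.

Fixpoint alive e t : bool :=
  if t is t'.+1 then alive e t' && safe p c (pos e t) else safe p c (pos e 0).

Lemma alive_safe e t : alive e t -> safe p c (pos e t).
Proof. by case: t => //= t /andP[]. Qed.

Lemma pos0 e : pos e 0 = 0.
Proof. by rewrite /pos /position big1 // => s; rewrite ltn0. Qed.

Lemma posS e (t : 'I_n) :
  pos e t.+1 = pos e t + (-1) ^+ S e t *: cube_vec R (e t).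
Proof.
rewrite /pos /position (bigD1 t) //= addrC; congr (_ + _).
by apply: eq_bigl => s; rewrite ltnS andbC -ltn_neqAle.
Qed.

Lemma strategy_update e (t : 'I_n) x (s : 'I_n) : (s < t)%N ->
  S (update e t x) s = S e s.
Proof.
move=> st; apply: onS => r rs; rewrite ffunE; case: eqP => // rt.
by move: rs; rewrite rt leqNgt st.
Qed.

(** The position at time [s] uses only the rounds of index below [s], so time [t] itself still
    precedes the use of the resampled vector [t]. *)
Lemma pos_update e (t : 'I_n) x s : (s <= t)%N -> pos (update e t x) s = pos e s.
Proof.
move=> st; apply: eq_bigr => r rs.
have rt : (r < t)%N by apply: leq_trans st.
rewrite strategy_update // ffunE; case: eqP => // rE.
by rewrite rE ltnn in rt.
Qed.

Lemma alive_update e (t : 'I_n) x s : (s <= t)%N ->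
  alive (update e t x) s = alive e s.
Proof.
elim: s => [|s IH] st /=; first by rewrite pos_update.
by rewrite IH ?(ltnW st) // pos_update.
Qed.

Definition weight e t : R :=
  if alive e t then expR (la * (rpot p c (pos e t) - t%:R / n%:R))
  else expR (2 * la).

(** Resample the vector of round [t]. The state before that round is unchanged because the strategy
    is online, so the inner sum is either constant or controlled by [greedy_exp_step]. *)
Lemma weight_step (t : 'I_n) : \sum_e weight e t.+1 <= \sum_e weight e t.
Proof.
have N0 : 0 < #|cube n|%:R :> R by rewrite ltr0n; apply/card_gt0P; exists [ffun=> true].
have n1 : 0 < n%:R :> R by rewrite ltr0n.
rewrite -(ler_pM2l N0) ![#|cube n|%:R * _]mulr_natl -(sum_update _ _ _ t) -sumrMnl.
apply: ler_sum => e _; rewrite {2}/weight.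
case: ifPn => [al|dead]; last first.
  rewrite -[leRHS](sumr_const (cube n)); apply: ler_sum => x _.
  by rewrite /weight /= alive_update // (negbTE dead).
set u := pos e t; have su : safe p c u := alive_safe _ _ al.
pose b (x : cube n) := S (update e t x) t.
have nextE x : pos (update e t x) t.+1 = u + (-1) ^+ b x *: cube_vec R x.
  by rewrite posS pos_update // ffunE eqxx.
have hb x b' : (potential_increment p c u (cube_vec R x) (b x) <=
                potential_increment p c u (cube_vec R x) b')%E.
  have := grS (update e t x) t b'; rewrite /= -/(pos _ t) pos_update //.
  by rewrite ffunE eqxx.
apply: (@le_trans _ _ (\sum_(x : cube n) expR (- (la * (t%:R / n%:R))) *
    expR (la * (rpot p c (u + (-1) ^+ b x *: cube_vec R x) - n%:R^-1)))).
  apply: ler_sum => x _; rewrite /weight /= alive_update // al nextE /=.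
  set u' := u + _.
  have [g1 _] := @greedy_rpot R n p c C hC C0 p2 n0 c324 cB1 u x (b x) su (hb x).
  rewrite -expRD; case: ifPn => [_|]; rewrite ler_expR.
    by rewrite -natr1 mulrDl; lra.
  (* The gaps are still positive after the move, so safety can only fail through [Phi > 3]. *)
  rewrite /safe negb_and => /orP[/forallP//|]; rewrite -ltNge => h3.
  have tn : t%:R / n%:R + n%:R^-1 <= 1 :> R.
    by rewrite -{2}[n%:R^-1]mul1r -mulrDl natr1 ler_pdivrMr // mul1r ler_nat.
  have := ler_wpM2l la0 (ltW h3); have := ler_wpM2l la0 tn; lra.
rewrite -mulr_sumr.
have := @greedy_exp_step R n p c C la hC C0 p2 n0 c324 cB1 cB2 la0 laB u b su hb.
move=> /(ler_wpM2l (expR_ge0 (- (la * (t%:R / n%:R))))) /le_trans; apply.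
by rewrite mulrCA -expRD addrC -mulrBr [leLHS]mulr_natl.
Qed.

(** Markov's inequality: the weight averages [exp(la)] at time 0, its average never increases, and
    every dead sequence weighs [exp(2 la)] at time [n]. *)
Lemma count_dead :
  #|[set e | ~~ alive e n]%SET|%:R <=
  expR (- la) * #|{ffun 'I_n -> cube n}|%:R.
Proof.
have mono t : (t <= n)%N -> \sum_e weight e t <= \sum_e weight e 0.
  elim: t => // t IH tn; apply: le_trans (IH (ltnW tn)).
  exact: (weight_step (Ordinal tn)).
have W0 : \sum_e weight e 0 = #|{ffun 'I_n -> cube n}|%:R * expR la.
  rewrite (eq_bigr (fun=> expR la)) ?sumr_const ?mulr_natl // => e _.
  by rewrite /weight /= pos0 safe0 // rpot0 // mul0r subr0 mulr1.
have Wn : expR (2 * la) * #|[set e | ~~ alive e n]%SET|%:R <= \sum_e weight e n.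
  rewrite -sum1_card natr_sum mulr_sumr big_mkcond /=; apply: ler_sum => e _.
  rewrite inE /weight; case: (alive e n) => /=; first exact: expR_ge0.
  by rewrite mulr1.
have := le_trans Wn (mono n (leqnn n)); rewrite W0.
rewrite -ler_pdivlMl ?expR_gt0 // -expRN => /le_trans; apply.
rewrite mulrCA -expRD mulrC le_eqVlt; apply/orP; left; apply/eqP.
by congr (expR _ * _); ring.
Qed.

End Process.

(** * From probability to counting, and the conclusion *)

(** The event is a finite disjoint union of the events that fix all the values, and independence
    with uniformity gives each of these the same probability. *)
Lemma prob_uniform_family (R : realType) (d : measure_display)
    (T : measurableType d) (P : probability T R) (I U : finType)
    (v : I -> T -> U) (A : {set {ffun I -> U}}) :
  (forall i, fin_random (v i)) -> (forall i, uniformly_distributed P (v i)) ->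
  mutually_independent P v ->
  P [set w | finfun (v ^~ w) \in A] = (#|A|%:R / #|{ffun I -> U}|%:R)%:E.
Proof.
move=> mv uv iv.
pose E (e : {ffun I -> U}) :=
  \bigcap_(i in [set i | i \in [set: I]%SET]) (v i @^-1` [set e i]).
have EP e w : E e w <-> finfun (v ^~ w) = e.
  split=> [Ew|<- i _]; last by rewrite /= ffunE.
  by apply/ffunP => i; rewrite ffunE; apply: (Ew i); rewrite /= inE.
have mE e : measurable (E e).
  by apply: fin_bigcap_measurable => // i _; exact: mv.
have PE e : P (E e) = (#|{ffun I -> U}|%:R^-1)%:E.
  rewrite /E (iv [set: I]%SET (fun i => [set e i])).
  rewrite (eq_bigr (fun=> (#|U|%:R^-1)%:E)); last by move=> i _; exact: uv.
  rewrite prodEFin prodr_const cardsT card_ffun natrX exprVn.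
  by [].
have -> : [set w | finfun (v ^~ w) \in A] = \bigcup_(e in [set` A]) E e.
  apply/seteqP; split=> w /=.
    by move=> Aw; exists (finfun (v ^~ w)) => //; apply/EP.
  by move=> [e /= eA /EP ->].
rewrite measure_fin_bigcup //; last first.
- by move=> e e' _ _ [w [/EP <- /EP]].
rewrite -(@bigfs _ _ _ _ (index_enum {ffun I -> U})) ?index_enum_uniq //; last first.
  by move=> e _; rewrite mem_index_enum.
rewrite (eq_bigr (fun=> (#|{ffun I -> U}|%:R^-1)%:E)); last by move=> e _; exact: PE.
by rewrite sumEFin sumr_const [in RHS]mulr_natl.
Qed.

Lemma mx_norm_le (R : realType) (m n : nat) (u : 'M[R]_(m, n)) (K : R) :
  0 <= K -> (forall i j, `|u i j| <= K) -> `|u| <= K.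
Proof.
move=> K0 hu; have [->//|] := eqVneq `|u| 0.
by move=> /mx_norm_neq0[[i j] /= uE]; rewrite [`|u|]uE.
Qed.

Theorem theorem1 (R : realType) (p : nat) (hp : (4 <= p)%N) :
  exists c0 : R, forall c : R, c0 <= c ->
  exists K a : R, [/\ 0 < K, 0 < a &
    forall (n : nat) (d : measure_display) (T : measurableType d)
           (P : probability T R) (v : 'I_n -> T -> cube n) (S : strategy n),
      (0 < n)%N ->
      (forall t : 'I_n, fin_random (v t)) ->
      (forall t : 'I_n, uniformly_distributed P (v t)) ->
      mutually_independent P v ->
      online S ->
      greedy p c S ->
      ((1 - expR (- (a * n%:R `^ (1 - 2 / p%:R))))%:E <=
       P [set w | (discrepancy R S (fun t => v t w) <= K * Num.sqrt n%:R)%R])%E].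
Proof.
have p2 : (2 <= p)%N by apply: leq_trans hp.
have [C C0 hC] := @inv_pow_second_order R p.
have p1 : 1 <= p%:R :> R by rewrite ler1n (leq_trans _ p2).
set B := p%:R + 10 * C.
have B1 : 1 <= B by rewrite /B; lra.
have B2 := sqr_ge0 B.
exists (324 + 3 * (p%:R + 2 * C) + 192 * B ^+ 2) => c hc.
have c324 : 324 <= c by lra.
have cB1 : 3 * (p%:R + 2 * C) <= c by lra.
have cB2 : 192 * B ^+ 2 <= c by lra.
have c0 : 0 < c by lra.
(* A positive gap means [d_j^2 < c n], whence [K = sqrt c]. The value of [a] turns [laB] into the
   equality [27 / 216 = 1 / 8]. *)
exists (Num.sqrt c), (c / (216 * B)); split.
- by rewrite sqrtr_gt0.
- by rewrite divr_gt0 // mulr_gt0 //; lra.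
move=> n d T P v S n0 mv uv iv onS grS.
set G := n%:R `^ _; set la := _ * G.
have G0 : 0 < G by rewrite powR_gt0 // ltr0n.
have la0 : 0 <= la by rewrite mulr_ge0 ?(ltW G0) // divr_ge0; lra.
have laB : la * (B * (27 / c / G)) <= 1 / 8.
  rewrite le_eqVlt; apply/orP; left; apply/eqP; rewrite /la; field.
  by rewrite !gt_eqF //; lra.
pose A : {set {ffun 'I_n -> cube n}} :=
  [set e : {ffun 'I_n -> cube n} |
    discrepancy R S e <= Num.sqrt c * Num.sqrt n%:R]%SET.
have -> : [set w | discrepancy R S (v ^~ w) <= Num.sqrt c * Num.sqrt n%:R] =
    [set w | finfun (v ^~ w) \in A].
  apply/seteqP; split=> w /=; rewrite inE;
    by have -> : finfun (v ^~ w) = v ^~ w :> (_ -> _) by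
      apply/funext => t; rewrite ffunE.
rewrite prob_uniform_family // lee_fin.
have N0 : 0 < #|{ffun 'I_n -> cube n}|%:R :> R.
  by rewrite ltr0n; apply/card_gt0P; exists [ffun=> [ffun=> true]].
rewrite ler_pdivlMr // mulrBl mul1r lerBlDr -lerBlDl.
apply: le_trans (@count_dead R n p c C la hC C0 p2 n0 c324 cB1 cB2 la0 laB
  S onS grS).
rewrite -(cardsC A) natrD addrC addKr ler_nat; apply: subset_leq_card.
(* Contrapositive: a sequence alive at time [n] has positive gaps there, hence small discrepancy. *)
apply/fintype.subsetP => e; rewrite !inE; apply: contra => /alive_safe /andP[/forallP g _].
apply: mx_norm_le => [|i j]; first by rewrite mulr_ge0 ?sqrtr_ge0.
rewrite (ord1 i) -sqrtrM ?(ltW c0) // -sqrtr_sqr ler_wsqrtr //.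
by have := g j; rewrite /gap subr_gt0 => /ltW.
Qed.
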